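(* Let $q$ be a prime power, let $\epsilon,\phi\in\{1,-1\}$ and let $\lambda\in\mathbb F_q$. The set $$\mathcal R_\lambda(\epsilon,\phi)=\{(\ell,m)\in\mathcal L_\epsilon\times\mathcal L_\phi:\ell\ne m,\ \hat\rho(\ell,m)=\lambda\}$$ is nonempty precisely when one of the following holds: (i) $\epsilon=\phi=1$ and $\lambda\in\mathbf T_0^+$; (ii) $\epsilon\ne\phi$ and $\lambda\in\mathbf T_1^+$; (iii) $\epsilon=\phi=-1$, and $\lambda\in\mathbf T_0^*$ if $q$ is even, or $\lambda\in\mathbf T_0^+\setminus\{1/4\}$ if $q$ is odd.
   Context: Let $q$ be a prime power. Projective plane and conic. - Points of $\mathrm{PG}(2,K)$ are nonzero column vectors up to scalars, and $\mathrm{PG}(2,q)\subset\mathrm{PG}(2,q^2)$. - $P_\xi=(\xi,\xi^2,1)^\top$ and $P_\infty=(0,1,0)^\top$. - $\mathcal O_{q^2}=\{P_\xi:\xi\in\mathbb F_{q^2}\cup\{\infty\}\}$, and $\mathcal O=\{P_\xi:\xi\in\mathbb F_q\cup\{\infty\}\}$. - $\mathcal L_1$ (resp. $\mathcal L_{-1}$) is the set of lines of $\mathrm{PG}(2,q)$ meeting $\mathcal O$ in $2$ (resp. $0$) points. Viewed in $\mathrm{PG}(2,q^2)$, each such line meets $\mathcal O_{q^2}$ in two points. Cross-ratio. - With $v_x=(x,1)^\top$ and $v_\infty=(1,0)^\top$, $\rho(\alpha,\beta,\gamma,\delta)$ (no three equal) is the point $(\det(v_\alpha,v_\gamma)\det(v_\beta,v_\delta),\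 \det(v_\alpha,v_\delta)\det(v_\beta,v_\gamma))^\top$ of $\mathrm{PG}(1,q^2)=\mathbb F_{q^2}\cup\{\infty\}$. For finite entries this equals $\frac{(\alpha-\gamma)(\beta-\delta)}{(\alpha-\delta)(\beta-\gamma)}$. The function $f$ on $\mathbb F_{q^2}\cup\{\infty\}$. - $f(w)=1/(w+w^{-1})$ ($q$ even) or $\frac14+1/(-2+w+w^{-1})$ ($q$ odd), for $w\ne0,1,\infty$. - $f(1)=\infty$, and $f(0)=f(\infty)$ equals $0$ ($q$ even) or $1/4$ ($q$ odd). Modified cross-ratio. - For $\ell\cap\mathcal O_{q^2}=\{P_\alpha,P_\beta\}$ and $m\cap\mathcal O_{q^2}=\{P_\gamma,P_\delta\}$: $\hat\rho(\ell,m)=f(\rho(\alpha,\beta,\gamma,\delta))$. The sets $\mathbf T_e$. - If $q=2^r$: $\mathbf T_e$ is the set of $x\in\mathbb F_q$ with absolute trace $x+x^2+\cdots+x^{2^{r-1}}=e$. - If $q$ is odd: $\mathbf T_0$ is the set of nonzero squares in $\mathbb F_q$, and $\mathbf T_1$ is the set of non-squares. - $\mathbf T_e^+=\mathbf T_e$ if $q$ is even, and $\mathbf T_e^+=\mathbf T_e\cup\{0\}$ if $q$ is odd. - $\mathbf T_0^*=\mathbf T_0\setminus\{0\}$. *)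

(* Defs.v *)
From HB Require Import structures.
From mathcomp Require Import all_boot all_order all_algebra.

Set Implicit Arguments.
Unset Strict Implicit.
Unset Printing Implicit Defensive.

Import GRing.Theory.
Local Open Scope ring_scope.

(* Points of PG(2, K) are the 1-dimensional subspaces of K^3, lines are the   *)
(* 2-dimensional ones, and incidence is inclusion.  K u {oo} is option K,     *)
(* with None for oo.                                                          *)

Section Conic.
Variable K : finFieldType.

Definition conic_vec (xi : option K) : 'cV[K]_3 :=
  if xi is Some x then \col_i [:: x; x ^+ 2; 1]`_i else \col_i [:: 0; 1; 0]`_i.

Definition conic_point (xi : option K) : {vspace 'cV[K]_3} :=
  <[conic_vec xi]>%VS.

Definition conic : seq {vspace 'cV[K]_3} :=
  undup [seq conic_point xi | xi : option K].

Definition conic_meet (l : {vspace 'cV[K]_3}) : seq {vspace 'cV[K]_3} :=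
  [seq P <- conic | (P <= l)%VS].

(* For e = 1 the secant lines, for e = -1 the external lines. *)
Definition line_class (e : int) (l : {vspace 'cV[K]_3}) : bool :=
  (\dim l == 2%N) &&
  ((e == 1) && (size (conic_meet l) == 2%N)
   || (e == -1) && (size (conic_meet l) == 0%N)).

Definition conic_params (l : {vspace 'cV[K]_3}) : seq (option K) :=
  enum [set xi : option K | (conic_point xi <= l)%VS].

Definition pg1_vec (x : option K) : 'cV[K]_2 :=
  if x is Some a then \col_i [:: a; 1]`_i else \col_i [:: 1; 0]`_i.

Definition det2 (u v : 'cV[K]_2) : K := \det (row_mx u v : 'M[K]_2).

(* The point (a, b)^T of PG(1, K) as an element of K u {oo}. *)
Definition pg1_coord (a b : K) : option K :=
  if b == 0 then None else Some (a / b).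

Definition cross_ratio (a b c d : option K) : option K :=
  let D x y := det2 (pg1_vec x) (pg1_vec y) in
  pg1_coord (D a c * D b d) (D a d * D b c).

(* Used with #|K| = q ^ 2, which has the parity of q. *)
Definition modf (w : option K) : option K :=
  let c := if odd #|K| then 4^-1 else 0 in
  match w with
  | None => Some c
  | Some x =>
      if x == 0 then Some c
      else if x == 1 then None
      else Some (if odd #|K| then 4^-1 + (- 2 + x + x^-1)^-1
                 else (x + x^-1)^-1)
  end.

(* For lines l, m of PG(2, K) with two points each on the conic.  Exchanging  *)
(* the two parameters of l, or those of m, inverts the cross-ratio, and       *)
(* modf w^-1 = modf w, so the order in which the parameters are listed is     *)
(* irrelevant.                                                                *)
Definition modified_cross_ratio (l m : {vspace 'cV[K]_3}) : option K :=
  let s := conic_params l in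
  let t := conic_params m in
  modf (cross_ratio (nth None s 0) (nth None s 1)
                    (nth None t 0) (nth None t 1)).

End Conic.

Section Extension.
Variables (F K : finFieldType) (iota : {rmorphism F -> K}).

Definition extend_line (l : {vspace 'cV[F]_3}) : {vspace 'cV[K]_3} :=
  <<[seq map_mx iota v | v in l]>>%VS.

Definition hat_rho (l m : {vspace 'cV[F]_3}) : option K :=
  modified_cross_ratio (extend_line l) (extend_line m).

Definition Rset (lambda : F) (eps phi : int) :
    pred ({vspace 'cV[F]_3} * {vspace 'cV[F]_3}) :=
  fun lm => [&& line_class eps lm.1, line_class phi lm.2, lm.1 != lm.2
              & hat_rho lm.1 lm.2 == Some (iota lambda)].

End Extension.

Section TraceAndSquareClasses.
Variable F : finFieldType.

Definition abs_trace2 (x : F) : F := \sum_(i < logn 2 #|F|) x ^+ (2 ^ i).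

Definition is_square (x : F) : bool := [exists y : F, x == y ^+ 2].

(* The index e is only meant to be 0 or 1. *)
Definition Tset (e : nat) : {set F} :=
  if odd #|F| then
    if e == 0%N then [set x | (x != 0) && is_square x]
    else [set x | ~~ is_square x]
  else [set x | abs_trace2 x == e%:R].

Definition Tplus (e : nat) : {set F} :=
  if odd #|F| then 0 |: Tset e else Tset e.

Definition T0star : {set F} := Tset 0 :\ 0.

End TraceAndSquareClasses.

(* Main.v *)
Require Import Defs.
From HB Require Import structures.
From mathcomp Require Import all_boot all_order all_algebra finfield ring zify.

Set Implicit Arguments.
Unset Strict Implicit.
Unset Printing Implicit Defensive.

Import GRing.Theory.
Local Open Scope ring_scope.

(* Write a line as a x + b y + c z = 0; it meets the conic where the form     *)
(* b X^2 + a X Y + c Y^2 vanishes.  Let D = a^2 - 4 b c be the discriminant   *)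
(* and R the resultant of two forms.  The Pluecker relation turns the         *)
(* modified cross-ratio of two lines into c0 + R / (D D'), where c0 is 1/4    *)
(* for odd q and 0 for even q.                                                *)
(* For odd q this is B^2 / (4 D D'), where B is the polar form, and a line is *)
(* secant or external as D is a nonzero square or a nonsquare, so D D' fixes  *)
(* the square class of lambda.  Conversely, with D = 4 d and D' = d'          *)
(* prescribed, the condition on the second line is a conic u^2 - d a^2 = s,   *)
(* which has a point over F_q.                                                *)
(* For even q one may take a = a' = 1, and then R has trace tr(bc) + tr(b'c') *)
(* while tr(bc) decides between secant and external.                          *)
(* Two distinct external lines have R <> 0: a common point on the conic would *)
(* be rational.  This excludes the value c0 in case (iii).                    *)

(** The question reduces to coefficients over [F]. A quadratic extension splits every quadratic over
    [F], so a line with nonzero discriminant acquires two conic points over [K] ([splits_iota]).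
    Hence [modified_cross_ratio_line] applies to both lines, and [RsetP] replaces the set of pairs
    by the condition [attained]. That condition is solved by [hat_rho_value_odd] and
    [exists_sqr_sub_mul_sqr] for odd q, by [abs_trace2_hat_rho] and [exists_trace1] for even q, and
    [nonsplit_resultant0] handles two external lines. *)

(** * Lines as kernels of linear forms *)

Section Line.
Variable F : fieldType.
Implicit Types (a b c : F) (l : {vspace 'cV[F]_3}).

Definition covec a b c : 'rV[F]_3 := \row_i [:: a; b; c]`_i.

(** The zero triple gives the whole space, hence the nonvanishing hypotheses below. *)
Definition line a b c : {vspace 'cV[F]_3} :=
  lker (linfun (mulmx (covec a b c) : 'cV[F]_3 -> 'M[F]_1)).

Lemma mem_line_covec a b c (v : 'cV[F]_3) :
  (v \in line a b c) = (\sum_j covec a b c 0 j * v j 0 == 0).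
Proof.
rewrite memv_ker lfunE /=; apply/eqP/eqP => [/matrixP/(_ 0 0)|e].
  by rewrite !mxE.
by apply/matrixP => i j; rewrite !ord1 !mxE.
Qed.

Lemma mem_line a b c (v : 'cV[F]_3) :
  (v \in line a b c) = (a * v 0 0 + b * v 1 0 + c * v 2%:R 0 == 0).
Proof.
rewrite mem_line_covec !big_ord_recl big_ord0 !mxE /= addr0 addrA.
by congr (_ + _ + _ == 0); congr (_ * v _ _); apply/val_inj.
Qed.

Lemma covec_neq0 a b c : (a, b, c) != (0, 0, 0) -> exists i, covec a b c 0 i != 0.
Proof.
move=> nz; apply/existsP; apply: contraNT nz => /existsPn w0.
have := (w0 0, w0 1, w0 2%:R); rewrite !mxE /= !negbK.
by case=> [[/eqP-> /eqP->] /eqP->].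
Qed.

Lemma dim_line a b c : (a, b, c) != (0, 0, 0) -> \dim (line a b c) = 2%N.
Proof.
move=> nz; have := limg_ker_dim (linfun (mulmx (covec a b c) : 'cV[F]_3 -> 'M[F]_1)) fullv.
rewrite capfv -/(line a b c) !dimvf dim_matrix.
set d := \dim (limg _) => e.
have d1 : d = 1%N.
  apply/eqP; rewrite eqn_leq; apply/andP; split.
    by rewrite (leq_trans (dimvS (subvf _))) // dimvf dim_matrix.
  rewrite lt0n dimv_eq0; apply: contra nz => /eqP l0.
  have v0 v : v \in line a b c.
    by rewrite memv_ker -memv0 -l0 memv_img ?memvf.
  have := (v0 (delta_mx 0 0), v0 (delta_mx 1 0), v0 (delta_mx 2%:R 0)).
  rewrite !mem_line !mxE /= !mulr0 !mulr1 !add0r !addr0.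
  by case=> [[/eqP-> /eqP->] /eqP->].
by move: e; rewrite d1 addn1 => -[].
Qed.

(** A basis of [l] forms the columns of a 3 x 2 matrix, whose left kernel is nonzero; a nonzero
    vector in it is the required linear form, and dimensions agree. *)
Lemma lineP l : \dim l = 2%N -> exists a b c, (a, b, c) != (0, 0, 0) /\ l = line a b c.
Proof.
move=> dl.
pose M : 'M[F]_(3, 2) := \matrix_(i, j) (vbasis l)`_j i 0.
have : kermx M != 0.
  rewrite kermx_eq0 /row_free; apply: contraTneq (rank_leq_col M) => ->.
  by [].
case/rowV0Pn => w /sub_kermxP wM w0.
pose a := w 0 0; pose b := w 0 1; pose c := w 0 2%:R.
have ew : covec a b c = w.
  apply/rowP => i; rewrite !mxE /a /b /c.
  by case: i => -[|[|[|//]]] ? /=; congr (w _ _); apply/val_inj.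
have nz : (a, b, c) != (0, 0, 0).
  apply: contra w0 => /eqP[a0 b0 c0]; rewrite -ew a0 b0 c0.
  by apply/eqP/rowP => i; rewrite !mxE; case: i => -[|[|[|//]]].
exists a, b, c; split=> //; apply/eqP; rewrite eqEdim dl dim_line // andbT.
rewrite -(span_basis (vbasisP l)); apply/span_subvP => v /tnthP[i ->].
rewrite memv_ker lfunE /= ew; apply/eqP/matrixP => x y; rewrite !ord1 !mxE.
have i2 : (i < 2)%N := leq_trans (ltn_ord i) (eq_leq dl).
have /matrixP/(_ 0 (Ordinal i2)) := wM; rewrite !mxE => e; rewrite -[RHS]e.
apply: eq_bigr => j _; congr (_ * _).
by rewrite !mxE (tnth_nth 0).
Qed.

End Line.

Section ExtendLine.
Variables (F K : finFieldType) (iota : {rmorphism F -> K}).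

(* The kernel of w with w_i <> 0 is spanned by the e_j - (w_j / w_i) e_i,     *)
(* which have entries in F.                                                   *)
Lemma extend_lineE (a b c : F) : (a, b, c) != (0, 0, 0) ->
  extend_line iota (line a b c) = line (iota a) (iota b) (iota c).
Proof.
move=> nz; apply/eqP; rewrite eqEsubv; apply/andP; split.
  apply/span_subvP => _ /imageP[v + ->].
  by rewrite !mem_line !mxE -!rmorphM -!rmorphD fmorph_eq0.
pose S := [seq map_mx iota v | v in line a b c].
have inS v : v \in line a b c -> map_mx iota v \in <<S>>%VS.
  by move=> vl; apply/memv_span/imageP; exists v.
apply/subvP => v; rewrite mem_line_covec => /eqP v0.
have [i wi] := covec_neq0 nz; set w := covec a b c in wi.
have wK (j : 'I_3) : iota [:: a; b; c]`_j = covec (iota a) (iota b) (iota c) 0 j.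
  by rewrite mxE; case: j => -[|[|[|//]]].
pose u j : 'cV[F]_3 := delta_mx j 0 - (w 0 j / w 0 i) *: delta_mx i 0.
have ul j : u j \in line a b c.
  rewrite mem_line_covec -/w.
  under eq_bigr => k _ do rewrite !mxE mulrBr.
  rewrite sumrB (bigD1 j) //= eqxx mulr1 big1 => [|k /negbTE->]; last by rewrite mulr0.
  rewrite (bigD1 i) //= !eqxx mulr1 big1 => [|k /negbTE->]; last by rewrite !mulr0.
  move: wi; rewrite !addr0 mxE => wi.
  by rewrite [X in _ - X]mulrC divfK ?subrr.
(* The multiples of [delta_mx i 0] add up to a multiple of the linear form at [v], which is zero. *)
suff -> : v = \sum_j v j 0 *: map_mx iota (u j).
  by apply: memv_suml => j _; rewrite memvZ ?inS.
apply/colP => k; rewrite summxE.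
under eq_bigr => j _ do rewrite !mxE rmorphB rmorphM fmorph_div !rmorph_nat eqxx !andbT mulrBr.
rewrite sumrB (bigD1 k) //= eqxx mulr1 big1 => [|j]; last first.
  by rewrite eq_sym => /negbTE->; rewrite mulr0.
under eq_bigr => j _ do rewrite !mulrA [v j 0 * _]mulrC wK.
by rewrite -!mulr_suml v0 !mul0r subr0 addr0.
Qed.

End ExtendLine.

(** * Binary quadratic forms on the conic *)

Section ConicRoots.
Variable F : finFieldType.

Definition qform (a b c : F) (xi : option F) : F :=
  if xi is Some x then b * x ^+ 2 + a * x + c else b.

Definition conic_roots a b c := [set xi : option F | qform a b c xi == 0].

Lemma conic_point_line a b c xi : (conic_point xi <= line a b c)%VS = (qform a b c xi == 0).
Proof.
rewrite -memvE mem_line; case: xi => [x|]; rewrite /= !mxE /=.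
  by rewrite mulr1 [a * x + _]addrC.
by rewrite !mulr0 mulr1 add0r addr0.
Qed.

Lemma conic_point_inj : injective (@conic_point F).
Proof.
move=> x y e.
have : conic_vec x \in conic_point y by rewrite -e memv_line.
case/vlineP => k /colP ek.
have := (ek 0, ek 1, ek 2%:R); rewrite /conic_vec.
case: x {e ek} => [x|]; case: y => [y|] //; rewrite !mxE /= ?mulr1 ?mulr0.
- by case=> -[-> _ <-]; rewrite mul1r.
- by case=> _ /eqP; rewrite oner_eq0.
- by case=> -[_ +] e; rewrite -e mul0r => /eqP; rewrite oner_eq0.
Qed.

Lemma conic_params_line a b c : conic_params (line a b c) = enum (conic_roots a b c).
Proof. by apply: eq_enum => xi; rewrite !inE conic_point_line. Qed.

Lemma size_conic_meet a b c : size (conic_meet (line a b c)) = #|conic_roots a b c|.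
Proof.
rewrite /conic_meet /conic undup_id ?map_inj_uniq //; last exact: conic_point_inj.
  rewrite size_filter count_map cardE size_filter -enumT; apply: eq_count => xi /=.
  by rewrite inE conic_point_line.
by rewrite -enumT enum_uniq.
Qed.

End ConicRoots.

Section HomogeneousForms.
Variable F : fieldType.
Implicit Types (a b c : F) (x y : option F).

(* Homogeneous coordinates (hom_x : hom_y) on PG(1, F). *)
Definition hom_x x : F := if x is Some t then t else 1.
Definition hom_y x : F := if x is Some t then 1 else 0.

Definition disc a b c := a ^+ 2 - 4%:R * (b * c).
Definition resultant a b c a' b' c' :=
  (b * c' - b' * c) ^+ 2 - (b * a' - b' * a) * (a * c' - a' * c).

Lemma hom_det_neq0 x y : x != y -> hom_x x * hom_y y - hom_x y * hom_y x != 0.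
Proof.
case: x => [x|]; case: y => [y|] //=; rewrite ?mulr1 ?mulr0 ?subr0 ?sub0r ?oppr_eq0 ?oner_eq0 //.
by rewrite subr_eq0.
Qed.

Definition hom_qform a b c x :=
  b * hom_x x ^+ 2 + a * (hom_x x * hom_y x) + c * hom_y x ^+ 2.

(** The form is [k] times the product of the two linear forms vanishing at its roots. Here [k] is
    [b] when both roots are finite and [- a] when one is infinite. *)
Lemma qform_factor a b c x y : (a, b, c) != (0, 0, 0) -> x != y ->
  hom_qform a b c x = 0 -> hom_qform a b c y = 0 ->
  exists k, [/\ k != 0, a = - k * (hom_x x * hom_y y + hom_x y * hom_y x),
     b = k * (hom_y x * hom_y y) & c = k * (hom_x x * hom_x y)].
Proof.
move=> nz xy; rewrite /hom_qform => qx qy.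
suff [k [ea eb ec]] : exists k, [/\ a = - k * (hom_x x * hom_y y + hom_x y * hom_y x),
     b = k * (hom_y x * hom_y y) & c = k * (hom_x x * hom_x y)].
  exists k; split=> //; apply: contra nz => /eqP k0.
  by rewrite ea eb ec k0 oppr0 !mul0r.
case: x y xy qx qy => [x|] [y|] //=;
  rewrite ?(expr0n, mulr1, mulr0, addr0, expr1n, mul0r).
- move=> xy qx qy; exists b.
  have xy0 : x - y != 0 by rewrite subr_eq0.
  have ea : a = - b * (x + y).
    apply/(mulfI xy0)/subr0_eq.
    have -> : (x - y) * a - (x - y) * (- b * (x + y)) =
      (b * x ^+ 2 + a * x + c) - (b * y ^+ 2 + a * y + c) by ring.
    by rewrite qx qy subrr.
  split=> //; first by rewrite mulr1.
  by apply/subr0_eq; rewrite -[RHS]qx ea; ring.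
- move=> _ qx b0; exists (- a); rewrite b0 in qx *.
  split; rewrite ?opprK ?add0r ?mulr0 ?mulr1 //.
  by apply/subr0_eq; rewrite -[RHS]qx; ring.
- move=> _ b0 qx; exists (- a); rewrite b0 in qx *.
  split; rewrite ?opprK ?mulr0 ?mul1r ?mulr1 //.
  by apply/subr0_eq; rewrite -[RHS]qx; ring.
Qed.

Lemma disc_factored (k x y z t : F) :
  disc (- k * (x * t + z * y)) (k * (y * t)) (k * (x * z)) = (k * (x * t - z * y)) ^+ 2.
Proof. by rewrite /disc; ring. Qed.

(** The four determinants pair each root of one form with each root of the other: they are exactly
    the factors of the numerator and denominator of the cross-ratio. *)
Lemma resultant_factored (k l x x' y y' z z' t t' : F) :
  resultant (- k * (x * t + z * y)) (k * (y * t)) (k * (x * z))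
      (- l * (x' * t' + z' * y')) (l * (y' * t')) (l * (x' * z')) =
  (k * l) ^+ 2 * (((x * y' - x' * y) * (z * t' - z' * t)) *
                  ((x * t' - z' * y) * (z * y' - x' * t))).
Proof.
rewrite /resultant.
set A := - k * _; set B := k * (y * t); set C := k * (x * z).
set A' := - l * _; set B' := l * (y' * t'); set C' := l * (x' * z').
have -> : B * C' - B' * C = k * l * (y * t * x' * z' - y' * t' * x * z).
  by rewrite /B /C /B' /C'; ring.
have -> : B * A' - B' * A =
    k * l * (y' * t' * (x * t + z * y) - y * t * (x' * t' + z' * y')).
  by rewrite /A /B /A' /B'; ring.
have -> : A * C' - A' * C =
    k * l * (x * z * (x' * t' + z' * y') - x' * z' * (x * t + z * y)).
  by rewrite /A /C /A' /C'; ring.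
ring.
Qed.

End HomogeneousForms.

Section ParameterPairs.
Variable K : finFieldType.
Implicit Types (a b c : K) (x y : option K).

Lemma det2_pg1 x y :
  det2 (pg1_vec x) (pg1_vec y) = hom_x x * hom_y y - hom_x y * hom_y x.
Proof.
have detE (A : 'M[K]_2) : \det A = A 0 0 * A 1 1 - A 0 1 * A 1 0.
  have l0 : lift 0 0 = 1 :> 'I_2 by apply/val_inj.
  have l1 : lift 1 0 = 0 :> 'I_2 by apply/val_inj.
  rewrite (expand_det_row _ 0) !big_ord_recl big_ord0 addr0 l0 /cofactor !det_mx11.
  by rewrite !mxE l0 l1 /= expr0 expr1 mul1r mulN1r mulrN.
have det2E (u v : 'cV[K]_2) : det2 u v = u 0 0 * v 1 0 - v 0 0 * u 1 0.
  rewrite /det2 detE -!(row_mxEl u v) -!(row_mxEr u v).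
  by congr (_ * _ - _ * _); congr (row_mx u v _ _); apply/val_inj.
by rewrite det2E; case: x => [x|]; case: y => [y|]; rewrite !mxE /=.
Qed.

Lemma conic_rootsE a b c x : (x \in conic_roots a b c) = (hom_qform a b c x == 0).
Proof.
rewrite inE /hom_qform.
by case: x => [x|] /=; rewrite ?expr1n ?mulr1 ?expr0n /= ?mulr0 ?addr0.
Qed.
End ParameterPairs.

Lemma odd_cardF (F : finFieldType) : odd #|F| = (2%:R != 0 :> F).
Proof.
have [p p_pr pF] := finPcharP F.
have eF : #|F| = _ := card_pprimeChar pF.
have := finNzRing_gt1 F; rewrite eF -(dvdn_pcharf pF) oddX.
case: (logn _ _) => [|n] //= _.
rewrite dvdn_prime2 //; case: (even_prime p_pr) => [->|op]; first by [].
by rewrite op; case: eqP op => // ->.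
Qed.

(** * The modified cross-ratio as a resultant *)

Section ModifiedCrossRatio.
Variable K : finFieldType.

(** For w = n/m, the inverse of -2 + w + 1/w is nm/(n - m)^2, and -2 vanishes in characteristic 2.
    The values at 0 and infinity fit because nm = 0 there; [n != m] excludes w = 1. *)
Lemma modf_frac (n m : K) : n != m ->
  modf (pg1_coord n m) = Some ((if odd #|K| then 4%:R^-1 else 0) + n * m / (n - m) ^+ 2).
Proof.
move=> nm; rewrite /pg1_coord.
case: eqP => [->|/eqP m0]; first by rewrite /= mulr0 mul0r addr0.
rewrite /= mulf_eq0 invr_eq0 (negbTE m0) orbF.
case: eqP => [->|/eqP n0]; first by rewrite !mul0r addr0.
rewrite (can2_eq (mulfVK m0) (mulfK m0)) mul1r (negbTE nm).
have nm0 : n - m != 0 by rewrite subr_eq0.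
case: ifP => od; congr (Some _).
  congr (_ + _); rewrite -[RHS]invrK invf_div; congr (_^-1).
  by field; rewrite nm0 m0.
rewrite add0r -[RHS]invrK invf_div; congr (_^-1).
have t0 : 2%:R = 0 :> K by apply/eqP/negbNE; rewrite -odd_cardF od.
have sqE : (n - m) ^+ 2 = n ^+ 2 + m ^+ 2.
  by apply/subr0_eq; rewrite -[RHS](mul0r (- (n * m))) -t0; ring.
have := expf_neq0 2 nm0; rewrite sqE => nm2.
by field; rewrite nm2 m0.
Qed.

(** With cross-ratio n/m, the resultant is (kl)^2 nm, and the product of the discriminants is (kl)^2
    (n - m)^2; the scalars cancel. *)
Lemma modified_cross_ratio_line (a b c a' b' c' : K) :
  #|conic_roots a b c| = 2%N -> #|conic_roots a' b' c'| = 2%N ->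
  (a, b, c) != (0, 0, 0) -> (a', b', c') != (0, 0, 0) ->
  modified_cross_ratio (line a b c) (line a' b' c') =
  Some ((if odd #|K| then 4%:R^-1 else 0) +
        resultant a b c a' b' c' / (disc a b c * disc a' b' c')).
Proof.
have two (A B C : K) : #|conic_roots A B C| = 2%N -> (A, B, C) != (0, 0, 0) ->
  exists x y k, [/\ enum (conic_roots A B C) = [:: x; y], x != y & k != 0] /\
   [/\ A = - k * (hom_x x * hom_y y + hom_x y * hom_y x),
     B = k * (hom_y x * hom_y y) & C = k * (hom_x x * hom_x y)].
  rewrite cardE => e nz.
  have uE := enum_uniq (conic_roots A B C).
  have mE x : x \in enum (conic_roots A B C) ->
     hom_qform A B C x = 0.
    by rewrite mem_enum conic_rootsE => /eqP.
  case: (enum _) e uE mE => [|x [|y [|//]]] //= _ + mE.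
  rewrite inE andbT => xy.
  have [k [k0 eA eB eC]] := qform_factor nz xy (mE x (mem_head _ _)) (mE y (mem_last x [:: y])).
  by exists x, y, k.
move=> r r' nz nz'.
have [x [y [k [[e xy k0] [ea eb ec]]]]] := two _ _ _ r nz.
have [z [t [l [[e' zt l0] [ea' eb' ec']]]]] := two _ _ _ r' nz'.
rewrite /modified_cross_ratio !conic_params_line e e' /= /cross_ratio !det2_pg1.
have := hom_det_neq0 xy; have := hom_det_neq0 zt.
move: ea eb ec ea' eb' ec'.
move: (hom_x x) (hom_x y) (hom_x z) (hom_x t) (hom_y x) (hom_y y) (hom_y z) (hom_y t)
  => xx xy' xz xt yx yy yz yt.
move=> -> -> -> -> -> -> dzt dxy.
(* Pluecker relation *)
have nm : (xx * yz - xz * yx) * (xy' * yt - xt * yy) -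
    (xx * yt - xt * yx) * (xy' * yz - xz * yy) =
  (xx * yy - xy' * yx) * (xz * yt - xt * yz) by ring.
have nm0 := mulf_neq0 dxy dzt; rewrite -nm subr_eq0 in nm0.
rewrite (modf_frac nm0) nm disc_factored.
rewrite disc_factored resultant_factored.
congr (Some (_ + _)).
set u := (X in (k * l) ^+ 2 * X).
rewrite -/u; clearbody u.
move: (_ - xy' * yx) (_ - xt * yz) dxy dzt {nm nm0} => d d' d0 d'0.
by field; rewrite k0 l0 d0 d'0.
Qed.

End ModifiedCrossRatio.

(** * Squares and traces in finite fields *)

Section QuadraticFibres.
Variable F : finFieldType.
Implicit Types (f : F -> F) (a x y : F).

Lemma card_le_double_image f :
  (forall y, #|[set x | f x == y]| <= 2)%N -> (#|F| <= #|f @: F| * 2)%N.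
Proof.
move=> f2; rewrite -[X in (X <= _)%N]sum1_card (partition_big_imset f) /= -sum_nat_const.
apply: leq_sum => y _; apply: leq_trans (f2 y).
by rewrite sum1_card subset_leq_card //; apply/subsetP => x; rewrite !inE.
Qed.

Lemma card_quad_fibre a y : (#|[set x : F | (x ^+ 2 + a * x == y)%R]| <= 2)%N.
Proof.
case: (pickP [pred x : F | x ^+ 2 + a * x == y]) => [x0 /eqP e0|none]; last first.
  by rewrite (_ : [set _ | _] = set0) ?cards0 //; apply/setP => x; rewrite !inE; exact: none.
apply: leq_trans (_ : #|[set x0; (- a - x0)%R]| <= 2)%N; last by rewrite cards2; case: eqP.
apply/subset_leq_card/subsetP => x; rewrite !inE -e0 -subr_eq0.
have -> : x ^+ 2 + a * x - (x0 ^+ 2 + a * x0) = (x - x0) * (x - (- a - x0)) by ring.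
by rewrite mulf_eq0 !subr_eq0.
Qed.

(* Euler's criterion is the case f x = x ^ 2, and Artin-Schreier in           *)
(* characteristic 2 is f x = x ^ 2 + x.                                       *)
Lemma root_image f (p : {poly F}) y :
  p != 0 -> ((size p).-1 * 2 <= #|F|.+1)%N ->
  (forall z, #|[set x | f x == z]| <= 2)%N -> (forall x, root p (f x)) ->
  root p y = [exists x, y == f x].
Proof.
move=> p0 sp f2 rf.
pose R := [set z | root p z].
have sub : f @: F \subset R by apply/subsetP => _ /imsetP[x _ ->]; rewrite inE.
have cR : (#|R| < size p)%N.
  rewrite cardE; apply: max_poly_roots (enum_uniq _) => //.
  by apply/allP => z; rewrite mem_enum inE.
(* The image has at least half of |F| elements, while [p] has at most half of |F| + 1 roots, so the
   inclusion is an equality. *)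
have /eqP eR : f @: F == R.
  rewrite eqEcard sub /=.
  have := card_le_double_image f2; move: sp cR.
  move: #|R| #|F| #|_ @: _| (size p) => r q i s; lia.
have -> : root p y = (y \in R) by rewrite inE.
by rewrite -eR; apply/imsetP/existsP => [[x _ ->]|[x /eqP->]]; exists x.
Qed.

Lemma not_onto f x y : x != y -> f x = f y -> exists z, z \notin codom f.
Proof.
move=> xy fxy; apply/existsP; apply: contraNT xy; rewrite negb_exists => /forallP h.
have /image_injP inj : #|image f F| == #|F|.
  by apply/eqP/eq_card => z; rewrite inE; have := h z; rewrite negbK => ->.
by apply/eqP/inj.
Qed.

(** Euler's criterion with exponent (q + 1)/2 in place of (q - 1)/2, so that zero counts as a
    square. *)
Lemma is_squareE y : odd #|F| -> is_square y = (y ^+ uphalf #|F| == y).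
Proof.
move=> od.
have q1 := finNzRing_gt1 F.
have u1 : (1 < uphalf #|F|)%N.
  by move: #|F| od q1 => q; lia.
pose p : {poly F} := 'X^(uphalf #|F|) - 'X.
have sp : size p = (uphalf #|F|).+1.
  by rewrite size_polyDl size_polyXn // size_polyN size_polyX.
have := @root_image (fun x => x ^+ 2) p y; rewrite /is_square => <-.
- by rewrite rootE !hornerE subr_eq0.
- by rewrite -size_poly_eq0 sp.
- by rewrite sp /=; move: #|F| od => q; lia.
- by move=> z; have := card_quad_fibre 0 z; under eq_finset => x do rewrite mul0r addr0.
- move=> x; rewrite rootE !hornerE -exprM.
  have -> : (2 * uphalf #|F| = #|F|.+1)%N by move: #|F| od => q; lia.
  by rewrite exprS expf_card subrr.
Qed.

End QuadraticFibres.

Section OddCharacteristic.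
Variable F : finFieldType.
Hypothesis od : odd #|F|.
Implicit Types x y : F.

Lemma expf_half x : x ^+ uphalf #|F| = x \/ x ^+ uphalf #|F| = - x.
Proof.
have : (x ^+ uphalf #|F|) ^+ 2 = x ^+ 2.
  have e : (uphalf #|F| * 2 = #|F|.+1)%N by move: #|F| od => q; lia.
  by rewrite -exprM e exprS expf_card expr2.
by move/eqP; rewrite eqf_sqr => /orP[] /eqP; [left|right].
Qed.

Lemma is_squareM_nonsquare x y :
  ~~ is_square x -> ~~ is_square y -> is_square (x * y).
Proof.
rewrite !is_squareE // exprMn.
by case: (expf_half x) (expf_half y) => -> [] ->; rewrite ?eqxx // mulrNN eqxx.
Qed.

Lemma is_square_sqr x : is_square (x ^+ 2).
Proof. by apply/existsP; exists x. Qed.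

Lemma is_squareM x y : is_square x -> is_square y -> is_square (x * y).
Proof.
by move=> /existsP[u /eqP->] /existsP[v /eqP->]; rewrite -exprMn is_square_sqr.
Qed.

Lemma is_squareMl x y : x != 0 -> is_square x -> is_square (x * y) = is_square y.
Proof.
move=> x0 sx; apply/idP/idP; last exact: is_squareM.
move: sx x0 => /existsP[u /eqP->]; rewrite expf_eq0 /= => u0 /existsP[v /eqP e].
apply/existsP; exists (v / u); rewrite expr_div_n -e mulrAC mulfV ?mul1r //.
by rewrite expf_eq0.
Qed.

Lemma is_square0 : is_square (0 : F).
Proof. by have := is_square_sqr (0 : F); rewrite expr0n. Qed.

Lemma is_square_mul x y : x != 0 -> y != 0 ->
  is_square (x * y) = (is_square x == is_square y).
Proof.
move=> x0 y0; case sx : (is_square x); first by rewrite is_squareMl // eq_sym eqb_id.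
case sy : (is_square y); first by rewrite mulrC is_squareMl // sx.
by rewrite is_squareM_nonsquare ?sx ?sy.
Qed.

Lemma exists_nonsquare : exists x, ~~ is_square x.
Proof.
have ne : (1 : F) != - 1.
  by rewrite -subr_eq0 opprK -[1 + 1]/(2%:R) -odd_cardF.
have [] := @not_onto F (fun x => x ^+ 2) 1 (- 1) ne; first by rewrite sqrrN.
move=> x nx; exists x; apply: contra nx => /existsP[y /eqP->].
exact: (codom_f (fun y => y ^+ 2)).
Qed.

(** Pigeonhole: the values u^2 and the values s + e a^2 each fill more than half of the field, so
    they meet. *)
Lemma exists_sqr_sub_mul_sqr (e s : F) : e != 0 -> exists u a, u ^+ 2 - e * a ^+ 2 = s.
Proof.
move=> e0; pose A := [set x ^+ 2 | x : F]; pose B := [set s + e * x ^+ 2 | x : F].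
have cA : (#|F| <= #|A| * 2)%N.
  apply: card_le_double_image => y; have := card_quad_fibre 0 y.
  by under eq_finset => x do rewrite mul0r addr0.
have cB : #|B| = #|A|.
  rewrite -(card_imset A (f := fun z => s + e * z)); last first.
    by move=> x y /addrI/(mulfI e0).
  by rewrite /A -imset_comp.
have : A :&: B != set0.
  rewrite -card_gt0; have := cardsUI A B; have := max_card (mem (A :|: B)).
  rewrite cB; move: #|A| #|_ :|: _| #|_ :&: _| #|F| od cA => a b c q; lia.
case/set0Pn => z /setIP[/imsetP[u _ ->] /imsetP[a _ e1]].
by exists u, a; rewrite e1 addrK.
Qed.

End OddCharacteristic.

Section EvenCharacteristic.
Variable F : finFieldType.
Hypothesis ev : ~~ odd #|F|.
Implicit Types x y : F.

Lemma two_eq0 : 2%:R = 0 :> F.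
Proof. by apply/eqP; move: ev; rewrite odd_cardF negbK. Qed.

Lemma pchar_two : 2%N \in [pchar F].
Proof. by rewrite inE /= two_eq0. Qed.

Lemma oppr_even x : - x = x.
Proof. exact: oppr_pchar2 pchar_two _. Qed.

Lemma card_even : #|F| = (2 ^ logn 2 #|F|)%N.
Proof. exact: (card_pprimeChar pchar_two). Qed.

Lemma abs_trace2D x y : abs_trace2 (x + y) = abs_trace2 x + abs_trace2 y.
Proof.
rewrite /abs_trace2 -big_split; apply: eq_bigr => i _ /=.
by rewrite exprDn_pchar // pnatX pnatE // pchar_two.
Qed.

Lemma abs_trace2_sqr x : abs_trace2 (x ^+ 2) = abs_trace2 x.
Proof.
apply/subr0_eq; rewrite /abs_trace2 -sumrB.
under eq_bigr => i _ do rewrite -exprM -expnS.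
rewrite -(big_mkord xpredT (fun i => x ^+ (2 ^ i.+1) - x ^+ (2 ^ i))).
by rewrite telescope_sumr // -card_even expf_card expr1 subrr.
Qed.

Lemma sqr_abs_trace2 x : abs_trace2 x ^+ 2 = abs_trace2 (x ^+ 2).
Proof.
rewrite -(pFrobenius_autE pchar_two) /abs_trace2 raddf_sum; apply: eq_bigr => i _ /=.
by rewrite pFrobenius_autE -!exprM mulnC.
Qed.

Lemma abs_trace2_01 x : abs_trace2 x != 0 -> abs_trace2 x = 1.
Proof.
move=> x0; apply: (mulfI x0); rewrite -expr2 mulr1.
by rewrite sqr_abs_trace2 abs_trace2_sqr.
Qed.

(** The additive form of Hilbert 90: the trace polynomial has degree q/2 and vanishes on all y^2 +
    y, so [root_image] applies. *)
Lemma abs_trace2_eq0 x : (abs_trace2 x == 0) = [exists y, x == y ^+ 2 + y].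
Proof.
have q1 := finNzRing_gt1 F.
have [n en] : exists n, logn 2 #|F| = n.+1.
  by move: q1; rewrite {1}card_even; case: (logn _ _) => // n _; exists n.
pose p : {poly F} := \sum_(i < n.+1) 'X^(2 ^ i).
have sp : size p = (2 ^ n).+1.
  rewrite /p big_ord_recr /= addrC size_polyDl size_polyXn //.
  apply: leq_trans (size_sum _ _ _) _; apply/bigmax_leqP => i _.
  by rewrite size_polyXn ltn_exp2l.
have := @root_image F (fun y => y ^+ 2 + y) p x => <-.
- by rewrite rootE horner_sum /abs_trace2 en; under [in RHS]eq_bigr => i _ do rewrite hornerXn.
- by rewrite -size_poly_eq0 sp.
- by rewrite sp /= -expnSr -en -card_even.
- by move=> z; have := card_quad_fibre 1 z; under eq_finset => y do rewrite mul1r.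
- move=> y; rewrite rootE horner_sum; under eq_bigr => i _ do rewrite hornerXn.
  by rewrite -en -/(abs_trace2 _) abs_trace2D abs_trace2_sqr -{2}[abs_trace2 y]oppr_even subrr.
Qed.

Lemma exists_trace1 : exists x, abs_trace2 x = 1.
Proof.
suff [x x0] : exists x, abs_trace2 x != 0 by exists x; exact: abs_trace2_01.
have [] := @not_onto F (fun y => y ^+ 2 + y) 1 0 (oner_neq0 F).
  by rewrite expr1n expr0n addr0 -mulr2n two_eq0.
move=> x nx; exists x; rewrite abs_trace2_eq0; apply: contra nx => /existsP[y /eqP->].
exact: (codom_f (fun y => y ^+ 2 + y)).
Qed.

Lemma sqrt_even x : exists y, x = y ^+ 2.
Proof.
have /injF_onto/(_ x)/codomP[y ->] : injective (fun y : F => y ^+ 2).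
  by move=> y z /eqP; rewrite eqf_sqr oppr_even orbb => /eqP.
by exists y.
Qed.

End EvenCharacteristic.

(** * Secant and external lines *)

Section Splits.
Variable F : finFieldType.
Implicit Types a b c : F.

(* The equation b X^2 + a X + c = 0 made monic by y = b X, so that b = 0      *)
(* (one root at infinity, y = 0) needs no separate case.                      *)
Definition splits a b c := [exists y, y ^+ 2 + a * y + b * c == 0].

Lemma four_neq0 : odd #|F| -> 4%:R != 0 :> F.
Proof. by rewrite odd_cardF -[4%N]/(2 * 2)%N natrM mulf_eq0 orbb. Qed.

Lemma splits_odd a b c : odd #|F| -> splits a b c = is_square (disc a b c).
Proof.
move=> od; have t0 : 2%:R != 0 :> F by rewrite -odd_cardF.
apply/existsP/existsP => [[y /eqP ey]|[s /eqP es]].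
  exists (2%:R * y + a); apply/eqP/subr0_eq.
  transitivity (- 4%:R * (y ^+ 2 + a * y + b * c)); last by rewrite ey mulr0.
  by rewrite /disc; ring.
exists ((s - a) / 2%:R); apply/eqP.
transitivity ((s ^+ 2 - disc a b c) / 4%:R); last by rewrite es subrr mul0r.
by rewrite /disc; field; rewrite four_neq0.
Qed.

Lemma disc_even a b c : ~~ odd #|F| -> disc a b c = a ^+ 2.
Proof. by move=> ev; rewrite /disc -[4%N]/(2 * 2)%N natrM two_eq0 // !mul0r subr0. Qed.

(** The substitution y = a z leads to the Artin-Schreier equation z^2 + z = bc/a^2. *)
Lemma splits_even a b c : ~~ odd #|F| -> a != 0 ->
  splits a b c = (abs_trace2 (b * c / a ^+ 2) == 0).
Proof.
move=> ev a0; rewrite abs_trace2_eq0 //.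
apply/existsP/existsP => [[y /eqP ey]|[z /eqP ez]].
  exists (y / a); rewrite -subr_eq0.
  apply/eqP.
  transitivity (- (y ^+ 2 + a * y + b * c) / a ^+ 2 + (b * c / a ^+ 2) *+ 2); first by field.
  by rewrite ey oppr0 mul0r add0r -mulr_natl two_eq0 // mul0r.
exists (a * z); apply/eqP.
have -> : b * c = a ^+ 2 * (z ^+ 2 + z) by rewrite -ez; field.
transitivity (2%:R * (a ^+ 2 * (z ^+ 2 + z))); first by ring.
by rewrite two_eq0 // mul0r.
Qed.

Lemma conic_root_splits a b c x : x \in conic_roots a b c -> splits a b c.
Proof.
rewrite inE; case: x => [x|] /= /eqP e; apply/existsP.
  exists (b * x); apply/eqP; transitivity (b * (b * x ^+ 2 + a * x + c)); first by ring.
  by rewrite e mulr0.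
by exists 0; rewrite e expr0n !mulr0 mul0r !addr0.
Qed.

Lemma card_conic_roots_le2 a b c : (a, b, c) != (0, 0, 0) -> (#|conic_roots a b c| <= 2)%N.
Proof.
move=> nz; rewrite leqNgt; apply/negP => /card_gt2P[x [y [z [[xR yR zR] [xy yz zx]]]]].
move: xR yR zR; rewrite !conic_rootsE => /eqP xR /eqP yR.
have [k [k0 -> -> ->]] := qform_factor nz xy xR yR; rewrite /hom_qform.
have -> : k * (hom_y x * hom_y y) * hom_x z ^+ 2 +
  - k * (hom_x x * hom_y y + hom_x y * hom_y x) * (hom_x z * hom_y z) +
  k * (hom_x x * hom_x y) * hom_y z ^+ 2 =
  k * ((hom_x y * hom_y z - hom_x z * hom_y y) * (hom_x x * hom_y z - hom_x z * hom_y x)) by ring.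
apply/negP; rewrite !mulf_neq0 ?hom_det_neq0 //.
by rewrite eq_sym.
Qed.

Lemma disc_neq0_of_card2 a b c : (a, b, c) != (0, 0, 0) ->
  #|conic_roots a b c| = 2%N -> disc a b c != 0.
Proof.
move=> nz /eqP/cards2P[x [y [xy e]]].
have := (set21 x y, set22 x y); rewrite -e !conic_rootsE => -[/eqP xR /eqP yR].
have [k [k0 -> -> ->]] := qform_factor nz xy xR yR.
by rewrite disc_factored expf_neq0 // mulf_neq0 ?hom_det_neq0.
Qed.

Lemma card_conic_roots_split a b c : (a, b, c) != (0, 0, 0) ->
  disc a b c != 0 -> splits a b c -> #|conic_roots a b c| = 2%N.
Proof.
move=> nz d0 /existsP[y /eqP ey].
apply/eqP; rewrite eqn_leq card_conic_roots_le2 //=; apply/card_gt1P.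
case: (eqVneq b 0) => [b0|b0].
  have a0 : a != 0 by apply: contraNneq d0 => ->; rewrite /disc b0 expr0n !(mul0r, mulr0) subr0.
  exists None, (Some (- c / a)); split=> //; rewrite inE /= ?b0 //.
  by apply/eqP; field.
(* The roots of the monic equation are y and -a - y; they coincide only if the discriminant
   vanishes. *)
exists (Some (y / b)), (Some ((- a - y) / b)); split=> //.
- rewrite inE /=; apply/eqP; transitivity ((y ^+ 2 + a * y + b * c) / b); first by field.
  by rewrite ey mul0r.
- rewrite inE /=; apply/eqP; transitivity ((y ^+ 2 + a * y + b * c) / b); first by field.
  by rewrite ey mul0r.
apply: contraNneq d0 => -[] /(divIf b0) e.
have -> : disc a b c = (y - (- a - y)) ^+ 2 - 4%:R * (y ^+ 2 + a * y + b * c) by rewrite /disc; ring.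
by rewrite ey mulr0 subr0 {1}e subrr expr0n.
Qed.

(** A double root is rational: -a/(2b) for odd q, the square root of c/b for even q. So an external
    line has nonzero discriminant. *)
Lemma disc0_conic_root a b c : disc a b c = 0 -> conic_roots a b c != set0.
Proof.
move=> d0; apply/set0Pn; case: (eqVneq b 0) => [b0|b0].
  by exists None; rewrite inE /= b0.
case od : (odd #|F|).
  have t0 : 2%:R != 0 :> F by rewrite -odd_cardF.
  exists (Some (- a / (2%:R * b))); rewrite inE /=; apply/eqP.
  transitivity (- disc a b c / (4%:R * b)); last by rewrite d0 oppr0 mul0r.
  by rewrite /disc; field; rewrite b0 four_neq0.
move/negbT: od => ev; move/eqP: d0; rewrite disc_even // expf_eq0 /= => /eqP a0.
have [x ex] := sqrt_even ev (c / b); exists (Some x).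
rewrite inE /= -ex a0 mul0r addr0 mulrCA mulfV // mulr1 -mulr2n -mulr_natl.
by rewrite two_eq0 // mul0r.
Qed.

Lemma line_class_line (eps : int) a b c : (a, b, c) != (0, 0, 0) ->
  eps = 1 \/ eps = -1 ->
  line_class eps (line a b c) = (disc a b c != 0) && ((eps == 1) == splits a b c).
Proof.
move=> nz heps; rewrite /line_class dim_line // size_conic_meet /=.
have -> : (#|conic_roots a b c| == 2%N) = (disc a b c != 0) && splits a b c.
  apply/eqP/andP => [e|[]]; last exact: card_conic_roots_split.
  split; first exact: disc_neq0_of_card2.
  have /card_gt0P[x] : (0 < #|conic_roots a b c|)%N by rewrite e.
  exact: conic_root_splits.
have -> : (#|conic_roots a b c| == 0%N) = (disc a b c != 0) && ~~ splits a b c.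
  apply/idP/andP => [|[d0]].
    rewrite cards_eq0 => e; have d0 : disc a b c != 0.
      by apply: contraTneq e; exact: disc0_conic_root.
    split=> //; apply: contraL e => s.
    by rewrite -cards_eq0 card_conic_roots_split.
  rewrite cards_eq0; apply: contraNT => /set0Pn[x]; exact: conic_root_splits.
by case: heps => -> /=; case: (disc _ _ _ != 0); case: (splits _ _ _).
Qed.

Definition hat_rho_value (a b c a' b' c' : F) : F :=
  (if odd #|F| then 4%:R^-1 else 0) +
  resultant a b c a' b' c' / (disc a b c * disc a' b' c').

Definition attained (e e' : bool) (lambda : F) :=
  exists a b c a' b' c' : F, [/\ disc a b c != 0, disc a' b' c' != 0,
    e = splits a b c, e' = splits a' b' c' &
    line a b c != line a' b' c' /\ hat_rho_value a b c a' b' c' = lambda].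

End Splits.

(** * Passage to the quadratic extension *)

Section Extension.
Variables (F K : finFieldType) (iota : {rmorphism F -> K}).
Hypothesis cardK : #|K| = (#|F| ^ 2)%N.

Lemma odd_cardK : odd #|K| = odd #|F|.
Proof. by rewrite cardK oddX. Qed.

Lemma is_square_iota x : odd #|F| -> is_square (iota x).
Proof.
move=> od; rewrite is_squareE ?odd_cardK // -rmorphXn; apply/eqP; congr (iota _).
have [m em] : exists m, #|F| = m.*2.+1 by exists #|F|./2; rewrite -[LHS]odd_double_half od.
have xq := expf_card x; rewrite em in xq.
(* With q = 2m + 1, Euler's exponent (q^2 + 1)/2 is qm + (m + 1), and x^q = x reduces the power to
   x^(2m + 1) = x. *)
have -> : uphalf #|K| = (m.*2.+1 * m + m.+1)%N by rewrite cardK em; nia.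
by rewrite exprD exprM xq -exprD -{2}xq; congr (_ ^+ _); lia.
Qed.

(** On elements of [F] the second half of the sum repeats the first, as x^q = x, and twice anything
    is zero. *)
Lemma abs_trace2_iota x : ~~ odd #|F| -> abs_trace2 (iota x) = 0.
Proof.
move=> ev; rewrite /abs_trace2 cardK lognX.
under eq_bigr => i _ do rewrite -rmorphXn.
rewrite -rmorph_sum -(big_mkord xpredT (fun i => x ^+ (2 ^ i))) mul2n -addnn.
rewrite (big_cat_nat (n := logn 2 #|F|)) ?leq_addr //=.
rewrite -{2}[logn 2 #|F|]add0n big_addn addnK.
under [X in _ + X]eq_bigr => i _ do rewrite addnC expnD exprM -card_even // expf_card.
by rewrite -mulr2n -mulr_natl two_eq0 // mul0r rmorph0.
Qed.

Lemma disc_iota a b c : disc (iota a) (iota b) (iota c) = iota (disc a b c).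
Proof. by rewrite /disc -!rmorphM -rmorphXn -(rmorph_nat iota) -rmorphM -rmorphB. Qed.

Lemma resultant_iota a b c a' b' c' :
  resultant (iota a) (iota b) (iota c) (iota a') (iota b') (iota c') =
  iota (resultant a b c a' b' c').
Proof. by rewrite /resultant -!rmorphM -!rmorphB -!rmorphM -rmorphXn -rmorphB. Qed.

Lemma splits_iota a b c : disc a b c != 0 -> splits (iota a) (iota b) (iota c).
Proof.
move=> d0; case od : (odd #|F|).
  by rewrite splits_odd ?odd_cardK // disc_iota is_square_iota.
move/negbT: od => ev; rewrite disc_even // expf_eq0 /= in d0.
rewrite splits_even ?odd_cardK ?fmorph_eq0 // -rmorphXn -rmorphM -fmorph_div.
by rewrite abs_trace2_iota.
Qed.

Lemma disc_form_neq0 (a b c : F) : disc a b c != 0 -> (a, b, c) != (0, 0, 0).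
Proof. by apply: contraNneq => -[-> -> ->]; rewrite /disc expr0n !mulr0 subr0. Qed.

Lemma hat_rho_line (a b c a' b' c' : F) : disc a b c != 0 -> disc a' b' c' != 0 ->
  hat_rho iota (line a b c) (line a' b' c') = Some (iota (hat_rho_value a b c a' b' c')).
Proof.
move=> d0 d0'; have nz := disc_form_neq0 d0; have nz' := disc_form_neq0 d0'.
have nzK x y z : (x, y, z) != (0, 0, 0) -> (iota x, iota y, iota z) != (0, 0, 0).
  by rewrite !xpair_eqE !fmorph_eq0.
rewrite /hat_rho !extend_lineE // modified_cross_ratio_line ?nzK //; last 2 first.
- by rewrite card_conic_roots_split ?nzK ?splits_iota // disc_iota fmorph_eq0.
- by rewrite card_conic_roots_split ?nzK ?splits_iota // disc_iota fmorph_eq0.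
rewrite /hat_rho_value !disc_iota resultant_iota odd_cardK.
congr (Some _); rewrite [RHS]rmorphD [X in _ = _ + X]fmorph_div rmorphM.
by case: ifP => _; rewrite ?rmorph0 // fmorphV rmorph_nat.
Qed.

Lemma RsetP (lambda : F) (eps phi : int) :
  eps = 1 \/ eps = -1 -> phi = 1 \/ phi = -1 ->
  (exists l m, (l, m) \in Rset iota lambda eps phi) <->
  attained (eps == 1) (phi == 1) lambda.
Proof.
move=> heps hphi; split=> [[l [m /and4P/=[cl cm lm /eqP hr]]]|].
  have [/eqP dl _] := andP cl; have [/eqP dm _] := andP cm.
  have [a [b [c [nz el]]]] := lineP dl; have [a' [b' [c' [nz' em]]]] := lineP dm.
  subst l m; move: cl cm; rewrite !line_class_line // => /andP[d0 /eqP sl] /andP[d0' /eqP sm].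
  exists a, b, c, a', b', c'; split=> //; split=> //.
  by move: hr; rewrite hat_rho_line // => -[] /fmorph_inj.
case=> a [b [c [a' [b' [c' [d0 d0' s s' [lm e]]]]]]].
exists (line a b c), (line a' b' c'); apply/and4P; split=> //=.
- by rewrite line_class_line ?disc_form_neq0 // d0 s eqxx.
- by rewrite line_class_line ?disc_form_neq0 // d0' s' eqxx.
- by rewrite hat_rho_line // e.
Qed.

End Extension.

(** * Attained values *)

Section CommonRoots.
Variable F : finFieldType.
Implicit Types a b c : F.

(** The vectors (b', -a', 0), (c', 0, -a') and (0, c', -b') lie on the second line, hence on the
    first. *)
Lemma eq_line_minors a b c a' b' c' : line a b c = line a' b' c' ->
  [/\ a * b' = a' * b, a * c' = a' * c & b * c' = b' * c].
Proof.
move=> e; have mem x y z : a' * x + b' * y + c' * z = 0 -> a * x + b * y + c * z = 0.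
  move=> h; pose v : 'cV[F]_3 := \col_i [:: x; y; z]`_i.
  have : v \in line a' b' c' by rewrite mem_line !mxE /= h.
  by rewrite -e mem_line !mxE /= => /eqP.
split; apply/subr0_eq.
- by rewrite -(mem b' (- a') 0); ring.
- by rewrite -(mem c' 0 (- a')); ring.
- by rewrite -(mem 0 c' (- b')); ring.
Qed.

Lemma eq_line_resultant a b c a' b' c' : line a b c = line a' b' c' ->
  resultant a b c a' b' c' = 0.
Proof.
by case/eq_line_minors => e1 e2 e3; rewrite /resultant e3 e2 !subrr mulr0 expr0n subr0.
Qed.

Lemma nonsplit_b_neq0 a b c : ~~ splits a b c -> b != 0.
Proof. by apply: contraNneq => b0; apply: (@conic_root_splits _ _ _ _ None); rewrite inE /= b0. Qed.

(* Non-proportional forms with vanishing resultant would share the root - p / r. *)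
Lemma nonsplit_resultant0 a b c a' b' c' : ~~ splits a b c -> ~~ splits a' b' c' ->
  resultant a b c a' b' c' = 0 -> line a b c = line a' b' c'.
Proof.
move=> ns ns'; have b0 := nonsplit_b_neq0 ns; have b0' := nonsplit_b_neq0 ns'.
rewrite /resultant; set p := b * c' - _; set r := b * a' - _; set s := a * c' - _.
move/subr0_eq => prs.
have r0 : r = 0.
  apply/eqP; apply: contraNT ns => r0.
  apply: (@conic_root_splits _ _ _ _ (Some (- p / r))); rewrite inE /=; apply/eqP.
  transitivity ((b * p ^+ 2 - a * p * r + c * r ^+ 2) / r ^+ 2); first by field.
  (* The remaining sum is the expansion of a 3 x 3 determinant with (a, b, c) as a repeated row. *)
  rewrite prs; transitivity ((b * s - a * p + c * r) / r); first by field.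
  by rewrite (_ : b * s - _ + _ = 0) ?mul0r // /s /p /r; ring.
have p0 : p = 0 by move/eqP: prs; rewrite r0 mul0r expf_eq0 /= => /eqP.
apply/vspaceP => v; rewrite !mem_line.
set x := v 0 0; set y := v 1 0; set z := v 2%:R 0.
have e : b * (a' * x + b' * y + c' * z) = b' * (a * x + b * y + c * z).
  apply/subr0_eq; transitivity (r * x + p * z); first by rewrite /r /p; ring.
  by rewrite r0 p0 !mul0r addr0.
apply/eqP/eqP => h; first by apply: (mulfI b0); rewrite e h !mulr0.
by apply: (mulfI b0'); rewrite -e h !mulr0.
Qed.

End CommonRoots.

Section OddValues.
Variable F : finFieldType.
Hypothesis od : odd #|F|.
Implicit Types a b c : F.

(** The squared numerator rests on the identity B^2 = 4 R + D D', where B is the polar form of the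
    discriminant up to a constant factor. *)
Lemma hat_rho_value_odd a b c a' b' c' : disc a b c != 0 -> disc a' b' c' != 0 ->
  hat_rho_value a b c a' b' c' =
  ((2%:R * (b * c' + b' * c) - a * a') / 2%:R) ^+ 2 / (disc a b c * disc a' b' c').
Proof.
have t0 : 2%:R != 0 :> F by rewrite -odd_cardF.
move=> d0 d0'; rewrite /hat_rho_value od.
set B := _ - a * a'.
have : B ^+ 2 = 4%:R * resultant a b c a' b' c' + disc a b c * disc a' b' c'.
  by rewrite /B /resultant /disc; ring.
move: (disc _ _ _) (disc _ _ _) d0 d0' (resultant _ _ _ _ _ _) B => D D' D0 D0' R B e.
rewrite expr_div_n e; field.
by rewrite four_neq0 ?D0 ?D0'.
Qed.

Lemma attained_odd e e' (lambda : F) : attained e e' lambda <->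
  if e == e' then is_square lambda && (e || (lambda != 4%:R^-1))
  else (lambda == 0) || ~~ is_square lambda.
Proof.
have t0 : 2%:R != 0 :> F by rewrite -odd_cardF.
have f0 : 4%:R != 0 :> F by rewrite four_neq0.
have sq4 : is_square (4%:R : F) by rewrite -[4%N]/(2 * 2)%N natrM -expr2 is_square_sqr.
have sqV : is_square (4%:R^-1 : F).
  by rewrite -[4%N]/(2 * 2)%N natrM invfM -expr2 is_square_sqr.
split.
  case=> a [b [c [a' [b' [c' [d0 d0' s s' [lm hl]]]]]]].
  have /[!hat_rho_value_odd] // el := hl.
  have : is_square (lambda * (disc a b c * disc a' b' c')).
    by rewrite -el divfK ?mulf_neq0 // is_square_sqr.
  case: (eqVneq lambda 0) => [l0|l0] sq.
    by rewrite l0 is_square0 [0 == _]eq_sym invr_eq0 f0 orbT; case: eqP.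
  move: sq; rewrite is_square_mul ?mulf_neq0 // is_square_mul // -!splits_odd // -s -s'.
  case: (eqVneq e e') => [ee|_] /eqP-> //=; rewrite -{}ee {e'} in s' *.
  case: e s s' => //= s s'.
  apply: contra lm => /eqP l4; apply/eqP/nonsplit_resultant0; rewrite -?s -?s' //.
  move/eqP: hl; rewrite l4 /hat_rho_value od -[X in _ == X]addr0 (inj_eq (addrI _)).
  rewrite mulf_eq0 invr_eq0 (negbTE (mulf_neq0 d0 d0')) orbF.
  by move=> /eqP.
have cls (b : bool) : exists2 d : F, d != 0 & is_square d = b.
  case: b.
    by exists 1; rewrite ?oner_neq0 // -(expr1n F 2) is_square_sqr.
  have [d /negbTE nd] := exists_nonsquare od; exists d => //.
  by apply: contraFneq nd => ->; exact: is_square0.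
(* Equal lines would give the value 1/4, so any other value makes the lines constructed below
   distinct. For 1/4 itself, the secants given by XY and X^2 + XY share one conic point. *)
move=> H; case: (eqVneq lambda 4%:R^-1) => [l4|l4].
  move: H; rewrite l4 eqxx orbF sqV invr_eq0 (negbTE f0) /=.
  case: eqP => // <- ->.
  exists 1, 0, 0, 1, 1, 0; split.
  - by rewrite /disc expr1n !mulr0 subr0 oner_neq0.
  - by rewrite /disc expr1n !mulr0 subr0 oner_neq0.
  - by rewrite splits_odd // /disc !mulr0 subr0 is_square_sqr.
  - by rewrite splits_odd // /disc !mulr0 subr0 is_square_sqr.
  split; last first.
    have r0 : resultant 1 0 0 1 1 0 = 0 :> F by rewrite /resultant; ring.
    by rewrite /hat_rho_value od r0 mul0r addr0.
  by apply/eqP => /eq_line_minors[/eqP + _ _]; rewrite mulr1 mul1r oner_eq0.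
have [d1 d10 sd1] := cls e; have [d2 d20 sd2] := cls e'.
have /existsP[s /eqP es] : is_square (lambda * (d1 * d2)).
  case: (eqVneq lambda 0) => [->|l0]; first by rewrite mul0r is_square0.
  rewrite is_square_mul ?mulf_neq0 // is_square_mul // sd1 sd2.
  by move: H; rewrite (negbTE l0); case: (e == e') => [/andP[->]|/negbTE->].
(* The first form is X^2 - d1 Y^2; the second one, (a, b, b d1 + 2 s), is     *)
(* chosen with discriminant d2 and polar form 4 s.                            *)
have [u [a eu]] := exists_sqr_sub_mul_sqr od (4%:R * s ^+ 2 - d1 * d2) d10.
(* Multiplied by [d1], the equation disc = d2 becomes u^2 - d1 a^2 = 4 s^2 - d1 d2 with u = 2 d1 b +
   2 s. *)
pose b := (u - 2%:R * s) / (2%:R * d1).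
have D1 : disc 0 1 (- d1) = 4%:R * d1 by rewrite /disc; ring.
have D2 : disc a b (b * d1 + 2%:R * s) = d2.
  apply: (mulfI d10).
  have -> : d1 * d2 = 4%:R * s ^+ 2 - (u ^+ 2 - d1 * a ^+ 2) by rewrite eu; ring.
  by rewrite /disc /b; field; rewrite d10 t0.
have dn1 : disc 0 1 (- d1) != 0 by rewrite D1 mulf_neq0.
have dn2 : disc a b (b * d1 + 2%:R * s) != 0 by rewrite D2.
have hl : hat_rho_value 0 1 (- d1) a b (b * d1 + 2%:R * s) = lambda.
  rewrite hat_rho_value_odd // D1 D2.
  transitivity (s ^+ 2 / (d1 * d2)); first by field; rewrite t0 f0 d10 d20.
  by rewrite -es mulfK // mulf_neq0.
exists 0, 1, (- d1), a, b, (b * d1 + 2%:R * s); split=> //.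
- by rewrite splits_odd // D1 is_squareMl.
- by rewrite splits_odd // D2.
split=> //; apply: contra l4 => /eqP/eq_line_resultant r0.
by rewrite -hl /hat_rho_value r0 mul0r addr0 od.
Qed.

End OddValues.

Section EvenValues.
Variable F : finFieldType.
Hypothesis ev : ~~ odd #|F|.
Implicit Types a b c : F.

(** In characteristic 2 the value is X^2 + X plus the two normalised products, and X^2 + X has trace
    zero. *)
Lemma abs_trace2_hat_rho a b c a' b' c' : a != 0 -> a' != 0 ->
  abs_trace2 (hat_rho_value a b c a' b' c') =
  abs_trace2 (b * c / a ^+ 2) + abs_trace2 (b' * c' / a' ^+ 2).
Proof.
move=> a0 a0'; rewrite /hat_rho_value (negbTE ev) !disc_even // add0r.
pose X := (b * c' - b' * c) / (a * a').
have -> : resultant a b c a' b' c' / (a ^+ 2 * a' ^+ 2) =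
  X ^+ 2 + X + (b * c / a ^+ 2 + b' * c' / a' ^+ 2) - 2%:R * (b * c' / (a * a')).
  by rewrite /resultant /X; field; rewrite a0 a0'.
rewrite two_eq0 // mul0r subr0 !abs_trace2D // abs_trace2_sqr //.
by rewrite -mulr2n -mulr_natl two_eq0 // mul0r add0r.
Qed.

Lemma abs_trace2_splits a b c : a != 0 ->
  abs_trace2 (b * c / a ^+ 2) = (~~ splits a b c)%:R.
Proof.
move=> a0; rewrite splits_even //.
by case: eqP => [->//|/eqP/(abs_trace2_01 ev)].
Qed.

Lemma attained_even e e' (lambda : F) : attained e e' lambda <->
  abs_trace2 lambda = (e != e')%:R /\ [|| e, e' | lambda != 0].
Proof.
have trE (b b' : bool) : (~~ b)%:R + (~~ b')%:R = (b != b')%:R :> F.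
  by case: b b' => -[]; rewrite /= ?addr0 ?add0r // -mulr2n two_eq0.
split.
  case=> a [b [c [a' [b' [c' [d0 d0' s s' [lm hl]]]]]]].
  have [a0 a0'] : a != 0 /\ a' != 0.
    by move: d0 d0'; rewrite !disc_even // !expf_eq0.
  split; first by rewrite -hl abs_trace2_hat_rho // !abs_trace2_splits // -s -s' trE.
  case: e s => //= s; case: e' s' => //= s'.
  apply: contra lm => /eqP l0; apply/eqP/nonsplit_resultant0; rewrite -?s -?s' //.
  move/eqP: hl; rewrite l0 /hat_rho_value (negbTE ev) add0r.
  by rewrite mulf_eq0 invr_eq0 (negbTE (mulf_neq0 d0 d0')) orbF => /eqP.
have disc1 b c : disc 1 b c = 1 by rewrite disc_even // expr1n.
have d1 b c : disc 1 b c != 0 by rewrite disc1 oner_neq0.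
have spl b c : splits 1 b c = (abs_trace2 (b * c) == 0).
  by rewrite splits_even ?oner_neq0 // expr1n divr1.
have tr0 : abs_trace2 (0 : F) = 0.
  by apply/eqP; rewrite abs_trace2_eq0 //; apply/existsP; exists 0; rewrite expr0n addr0.
have hl b c b' c' : hat_rho_value 1 b c 1 b' c' = resultant 1 b c 1 b' c'.
  by rewrite /hat_rho_value (negbTE ev) add0r !disc1 mulr1 divr1.
have n1 : (1 == 0 :> F) = false by rewrite oner_eq0.
case=> tr ne; case: e tr ne => [|] tr ne.
  (* The forms XY and X^2 + XY + lambda Y^2 have resultant [lambda], whose trace also decides
     whether the second one splits. *)
  exists 1, 0, 0, 1, 1, lambda; split=> //.
  - by rewrite spl mulr0 tr0 eqxx.
  - by rewrite spl mul1r tr; case: e' {tr ne} => /=; rewrite ?eqxx ?n1.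
  split; last by rewrite hl /resultant; ring.
  by apply/eqP => /eq_line_minors[/eqP + _ _]; rewrite mulr1 mulr0 oner_eq0.
case: e' tr ne => /= tr l0.
  exists 1, 1, lambda, 1, 0, 0; split=> //.
  - by rewrite spl mul1r tr n1.
  - by rewrite spl mulr0 tr0 eqxx.
  split; last by rewrite hl /resultant; ring.
  by apply/eqP => /eq_line_minors[/eqP + _ _]; rewrite mulr1 mulr0 eq_sym oner_eq0.
(* Two forms X^2 + XY + t Y^2 have as resultant the square of the difference of their t. Shifting
   [th] by the square root of [lambda], of trace zero, keeps the trace 1. *)
have [th tth] := exists_trace1 ev; have [e ee] := sqrt_even ev lambda.
have te : abs_trace2 e = 0 by rewrite -abs_trace2_sqr // -ee.
exists 1, 1, th, 1, 1, (th + e); split=> //.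
- by rewrite spl mul1r tth n1.
- by rewrite spl mul1r abs_trace2D // tth te addr0 n1.
split; last by rewrite hl /resultant ee; ring.
apply: contra l0 => /eqP/eq_line_minors[_ /eqP + _].
by rewrite !mul1r -subr_eq0 addrAC subrr add0r ee => /eqP->; rewrite expr0n.
Qed.

End EvenValues.

(** * Assembling the sign and parity cases *)

Lemma sign_cases (eps phi : int) (A B C : Prop) :
  eps = 1 \/ eps = -1 -> phi = 1 \/ phi = -1 ->
  (if eps == 1 then if phi == 1 then A else B else if phi == 1 then B else C) <->
  [\/ (eps = 1 /\ phi = 1) /\ A, eps <> phi /\ B | (eps = -1 /\ phi = -1) /\ C].
Proof.
case=> -> [] -> /=; split; try by [case=> [[]|[]|[]] // [] | constructor 1 | constructor 2 | constructor 3].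
Qed.

Theorem mainTheorem12 (q : nat) (F K : finFieldType)
  (cardF : #|F| = q) (cardK : #|K| = (q ^ 2)%N) (iota : {rmorphism F -> K})
  (eps phi : int) (heps : eps = 1 \/ eps = -1) (hphi : phi = 1 \/ phi = -1)
  (lambda : F) :
  (exists l m : {vspace 'cV[F]_3}, (l, m) \in Rset iota lambda eps phi) <->
  [\/ (eps = 1 /\ phi = 1) /\ lambda \in Tplus F 0,
      eps <> phi /\ lambda \in Tplus F 1
    | (eps = -1 /\ phi = -1) /\
      (if odd q then lambda \in Tplus F 0 :\ 4^-1 else lambda \in T0star F)].
Proof.
have cardK' : #|K| = (#|F| ^ 2)%N by rewrite cardF.
apply: (iff_trans (RsetP iota cardK' lambda heps hphi)).
rewrite -cardF.
have T0 : odd #|F| -> (lambda \in Tplus F 0) = is_square lambda.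
  move=> od; rewrite /Tplus /Tset od /= !inE.
  by case: eqP => [->|]; rewrite ?is_square0.
have T1 : odd #|F| -> (lambda \in Tplus F 1) = (lambda == 0) || ~~ is_square lambda.
  by move=> od; rewrite /Tplus /Tset od /= !inE.
have Te e : ~~ odd #|F| -> (lambda \in Tplus F e) = (abs_trace2 lambda == e%:R).
  by move=> ev; rewrite /Tplus /Tset (negbTE ev) inE.
have Ts : ~~ odd #|F| -> (lambda \in T0star F) = (lambda != 0) && (abs_trace2 lambda == 0).
  by move=> ev; rewrite /T0star /Tset (negbTE ev) !inE.
apply: iff_trans (sign_cases _ _ _ heps hphi).
case od : (odd #|F|).
  apply: (iff_trans (attained_odd od _ _ _)).
  rewrite T0 // T1 // in_setD1 T0 //.
  by case: (eps == 1) (phi == 1) => -[] /=; rewrite ?andbT // andbC.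
move/negbT: od => ev; apply: (iff_trans (attained_even ev _ _ _)).
rewrite !Te // Ts //.
case: (eps == 1) (phi == 1) => -[] /=.
- by split=> [[->]|/eqP->].
- by split=> [[->]|/eqP->].
- by split=> [[->]|/eqP->].
by split=> [[-> ->]|/andP[-> /eqP->]]; rewrite ?eqxx.
Qed.
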